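(* Let $\xi_1,\dots,\xi_n$ be nonzero real numbers and let $p_1,\dots,p_n,q_1,\dots,q_n$ be integers such that $p_i>\lvert q_i\rvert>0$ for all $1\le i\le n$ and $\frac{p_1}{q_1},\dots,\frac{p_n}{q_n}$ are pairwise distinct. Assume that either $\xi_1$ is irrational or $p_1/q_1\notin\mathbb{Z}$. Then, for every integer $M\ge 1$, there exists an integer $l$ such that \[ \limsup_{k\to \infty}\left\{\sum_{i=1}^n\xi_i\left(\frac{p_i}{q_i}\right)^{kM+l}\right\} -\liminf_{k\to \infty}\left\{\sum_{i=1}^n\xi_i\left(\frac{p_i}{q_i}\right)^{kM+l}\right\}\ge \frac{1}{p_1\dotsm p_n}. \]
   Context: For a real number $x$, $\{x\}=x-\lfloor x\rfloor$ denotes its fractional part. *)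

(* Defs.v *)
From mathcomp Require Import all_boot all_order all_algebra.
From mathcomp Require Import all_classical all_reals all_analysis.

Set Implicit Arguments.
Unset Strict Implicit.
Unset Printing Implicit Defensive.

Import Order.TTheory GRing.Theory Num.Theory.

Local Open Scope ring_scope.

Definition frac_part (R : realType) (x : R) : R := x - (Num.floor x)%:~R.

(* Main.v *)
(* Put r_i = p_i / q_i, s_m = sum_i xi_i r_i^m, x_m = {s_m}, and let E be the
   shift of sequences.  The operator P(E) = prod_i (q_i E - p_i) kills s, so
   b = P(E) x = - P(E) floor(s) is a bounded sequence of integers.  All roots of
   P lie outside the unit disc, hence P(E) is inverted on bounded sequences by a
   geometrically converging series in E: up to a small error, x_m is determined
   by a long word b_m, ..., b_(m+N), and changing only b_m by a nonzero integer
   moves x_m by at least about 1 / (p_1 ... p_n).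

   If the conclusion failed for every residue l mod M, then m mod M together
   with a long word b_(m+1), ..., b_(m+N) would determine b_m for all large m,
   and a sequence that is deterministic backwards with finitely many states is
   eventually periodic. So b, and then x, would have an eventual period t, and
   s_(m+t) - s_m = sum_i xi_i (r_i^t - 1) r_i^m would be an integer for all
   large m. Applying prod_(i <> 1) (q_i E - p_i) leaves D r_1^m with D
   nonzero, an integer for all m: this forces r_1 to be an integer and xi_1 to
   be rational. *)
Require Import Defs.
From mathcomp Require Import all_boot all_order all_algebra.
From mathcomp Require Import all_classical all_reals all_analysis.
From mathcomp Require Import zify ring lra.
Import Order.TTheory GRing.Theory Num.Theory.
Local Open Scope ring_scope.

Set Implicit Arguments.
Unset Strict Implicit.
Unset Printing Implicit Defensive.

(** * Backward deterministic sequences with finitely many states *)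

(** Among |S|+1 consecutive states from [m + t] on, two agree, and backward determinism carries the
    coincidence down to [m]. Their distance is at most |S|, hence divides |S|!, so one period serves
    all [m]. *)
Lemma backward_deterministic_periodic (S : finType) (W : nat -> S) (m0 : nat) :
    (forall m m', (m0 <= m)%N -> (m0 <= m')%N ->
       W m.+1 = W m'.+1 -> W m = W m') ->
  forall m, (m0 <= m)%N -> W (m + (#|S|)`!)%N = W m.
Proof.
move=> backW m le_m0m; set t := ((#|S|)`!)%N.
have [i [j [lt_ij le_jS eqW]]] : exists i j : nat,
    [/\ (i < j)%N, (j <= #|S|)%N & W (m + t + i)%N = W (m + t + j)%N].
  pose f (i : 'I_#|S|.+1) := W (m + t + i)%N.
  have /injectivePn[i [j neq_ij eqf]] : ~~ injectiveb f.
    apply/negP => /injectiveP /leq_card; by rewrite card_ord ltnn.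
  have [lt_ij|lt_ji|/val_inj eq_ij] := ltngtP i j.
  - by exists i, j; split=> //; rewrite -ltnS.
  - by exists j, i; split=> //; rewrite -ltnS.
  - by rewrite eq_ij eqxx in neq_ij.
pose d := (j - i)%N.
have shift e : (e <= m + t + i - m0)%N ->
    W (m + t + i - e)%N = W (m + t + i - e + d)%N.
  elim: e => [_|e IHe le_e]; first by rewrite subn0 eqW /d; congr W; lia.
  apply: backW; [lia|lia|].
  have -> : (m + t + i - e.+1).+1 = (m + t + i - e)%N by lia.
  by rewrite IHe; [congr W; lia|lia].
have perd k : (k * d <= t)%N -> W (m + k * d)%N = W m.
  elim: k => [|k IHk le_k]; first by rewrite mul0n addn0.
  rewrite -IHk; last by lia.
  have := @shift (m + t + i - (m + k * d))%N.
  have -> : (m + t + i - (m + t + i - (m + k * d)))%N = (m + k * d)%N by lia.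
  by move=> ->; [congr W; lia|lia].
have d_dvd : (d %| t)%N by apply: dvdn_fact; lia.
by rewrite -(divnK d_dvd) perd // divnK.
Qed.

Lemma eventually_periodic (T : finType) (b : nat -> T) (M N m0 : nat) :
    (0 < M)%N ->
    (forall m m', (m0 <= m)%N -> (m0 <= m')%N -> m = m' %[mod M] ->
       (forall j, (j < N)%N -> b (m + j.+1)%N = b (m' + j.+1)%N) ->
       b m = b m') ->
  exists t, (0 < t)%N /\ forall m, (m0 <= m)%N -> b (m + t)%N = b m.
Proof.
move=> M_gt0 backb.
(* The window has N+1 letters, so that [b m] can be read off the state even when N = 0. *)
pose W m : 'I_M * {ffun 'I_N.+1 -> T} :=
  (Ordinal (ltn_pmod m M_gt0), [ffun j : 'I_N.+1 => b (m + j)%N]).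
have Wb m m' : W m = W m' ->
    m = m' %[mod M] /\ forall j, (j <= N)%N -> b (m + j)%N = b (m' + j)%N.
  case=> eq_mod /ffunP eqb; split=> // j le_jN.
  by have := eqb (Ordinal (le_jN : (j < N.+1)%N)); rewrite !ffunE.
have backW m m' : (m0 <= m)%N -> (m0 <= m')%N ->
    W m.+1 = W m'.+1 -> W m = W m'.
  move=> le_m le_m' /Wb[eq_mod eqb].
  have {}eq_mod : m = m' %[mod M].
    by apply/eqP; rewrite -(eqn_modDr 1) !addn1; apply/eqP.
  have eqb0 : b m = b m'.
    apply: backb => // j lt_jN.
    by rewrite -!addSnnS; apply: eqb; apply: ltnW.
  congr pair; first exact: val_inj.
  apply/ffunP => -[[|j] lt_j]; rewrite !ffunE /= ?addn0 //.
  by rewrite -!addSnnS; apply: eqb; rewrite ltnS in lt_j; apply: ltnW.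
exists ((#|{: 'I_M * {ffun 'I_N.+1 -> T}}|)`!)%N; split; first exact: fact_gt0.
move=> m le_m.
have /Wb[_ /(_ 0 isT)] := @backward_deterministic_periodic _ W m0 backW m le_m.
by rewrite !addn0.
Qed.

(** * Products of first-order shift operators *)

Section ShiftOperators.
Variables (R : realType) (I : eqType) (p q : I -> R).
Implicit Types (d : nat -> R) (s : seq I).

(* With E the shift, this is c E - a, and [prod_op s] is the product of the
   q_i E - p_i for i in [s]. *)
Definition factor_op (a c : R) d : nat -> R := fun m => c * d m.+1 - a * d m.

Definition prod_op s d : nat -> R :=
  foldr (fun i => factor_op (p i) (q i)) d s.

Lemma prod_opB s d d' m :
  prod_op s (fun k => d k - d' k) m = prod_op s d m - prod_op s d' m.
Proof.
by elim: s m => [|i s IHs] m //=; rewrite /factor_op !IHs; ring.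
Qed.

Lemma prod_op_sum s (J : finType) (d : J -> nat -> R) m :
  prod_op s (fun k => \sum_j d j k) m = \sum_j prod_op s (d j) m.
Proof.
elim: s m => [|i s IHs] m //=.
by rewrite /factor_op !IHs !mulr_sumr -sumrB.
Qed.

Lemma prod_op_shift s d t m :
  prod_op s (fun k => d (k + t)%N) m = prod_op s d (m + t)%N.
Proof. by elim: s m => [|i s IHs] m //=; rewrite /factor_op !IHs. Qed.

Lemma prod_op_geometric s a r m :
  prod_op s (fun k => a * r ^+ k) m =
  a * \prod_(i <- s) (q i * r - p i) * r ^+ m.
Proof.
elim: s m => [|i s IHs] m /=; first by rewrite big_nil mulr1.
by rewrite /factor_op !IHs big_cons exprS; ring.
Qed.

Lemma prod_op_int s d m :
    (forall i, p i \is a Num.int) -> (forall i, q i \is a Num.int) ->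
    (forall k, d k \is a Num.int) ->
  prod_op s d m \is a Num.int.
Proof.
move=> p_int q_int d_int; elim: s m => [|i s IHs] m //=.
by rewrite rpredB ?rpredM.
Qed.

Lemma prod_op_bounded s (B : R) : exists C : R, forall d,
  (forall k, `|d k| <= B) -> forall m, `|prod_op s d m| <= C.
Proof.
elim: s => [|i s [C bC]]; first by exists B.
exists (`|q i| * C + `|p i| * C) => d dB m /=.
rewrite (le_trans (ler_normB _ _)) // !normrM.
by rewrite lerD // ler_wpM2l // bC.
Qed.

(** Since a d_j is c d_(j+1) minus the operator's value, the supremum S of |d_j| theta^j satisfies a
    S <= (|c| / theta) S + A, which is solved for S. Boundedness of [d] makes S finite. *)
Lemma factor_op_bound (a c theta A B : R) d :
    0 < theta -> theta <= 1 -> `|c| < theta * a -> 0 <= A ->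
    (forall k, `|d k| <= B) ->
    (forall j, `|factor_op a c d j| * theta ^+ j <= A) ->
  forall j, `|d j| * theta ^+ j <= A / (a - `|c| / theta).
Proof.
move=> th_gt0 th_le1 lt_ca A_ge0 dB opA.
have gap : 0 < a - `|c| / theta by rewrite subr_gt0 ltr_pdivrMr // mulrC.
have a_gt0 : 0 < a.
  by rewrite (lt_le_trans gap) // gerBl divr_ge0 // ltW.
pose E := [set `|d j| * theta ^+ j | j in [set: nat]]%classic.
have supE : has_sup E.
  split; first by exists (`|d 0| * theta ^+ 0), 0%N.
  exists B => _ [j _ <-]; rewrite (le_trans _ (dB j)) //.
  by rewrite ler_piMr // exprn_ile1 // ltW.
suff S_le : sup E <= A / (a - `|c| / theta).
  move=> j; rewrite (le_trans _ S_le) //.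
  by apply: sup_upper_bound => //; exists j.
have : sup E <= (`|c| / theta * sup E + A) / a.
  apply: ge_sup => [|_ [j _ <-]]; first by case: supE.
  rewrite ler_pdivlMr //.
  have dS : `|d j.+1| * theta ^+ j.+1 <= sup E.
    by apply: sup_upper_bound => //; exists j.+1.
  have thj : 0 <= theta ^+ j by rewrite exprn_ge0 // ltW.
  have -> : `|d j| * theta ^+ j * a =
      `|c * d j.+1 - factor_op a c d j| * theta ^+ j.
    have -> : c * d j.+1 - factor_op a c d j = a * d j.
      by rewrite /factor_op; ring.
    by rewrite normrM (gtr0_norm a_gt0); ring.
  rewrite (le_trans (ler_wpM2r thj (ler_normB _ _))) // mulrDl lerD // normrM.
  have -> : `|c| * `|d j.+1| * theta ^+ j =
      `|c| / theta * (`|d j.+1| * theta ^+ j.+1).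
    by rewrite exprS; field; rewrite gt_eqF.
  by rewrite ler_wpM2l // divr_ge0 // ltW.
rewrite !ler_pdivlMr // => leS.
by rewrite mulrBr; lra.
Qed.

(* Since every root of the symbol lies outside the unit disc, [d m] is up to a
   geometrically small error the value of the operator at [m], divided by the
   constant coefficient, as soon as the operator vanishes on a long stretch
   after [m].  The weights [theta ^+ j] encode this decay. *)
Lemma prod_op_bound s (theta : R) :
    0 < theta -> theta <= 1 -> (forall i, `|q i| < theta * p i) ->
  exists2 K : R, 0 <= K & forall (A B : R) d, 0 <= A ->
    (forall k, `|d k| <= B) ->
    (forall j, `|prod_op s d j.+1| * theta ^+ j <= A) ->
    (forall j, `|d j.+1| * theta ^+ j <= K * A) /\
    `|prod_op s d 0| <= (\prod_(i <- s) p i) * `|d 0| + K * A.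
Proof.
move=> th_gt0 th_le1 lt_qp.
have p_gt0 i : 0 < p i.
  by rewrite -(pmulr_rgt0 _ th_gt0) (le_lt_trans _ (lt_qp i)).
elim: s => [|i s [K K_ge0 IHs]].
  exists 1 => // A B d A_ge0 dB dA; split=> [j|]; first by rewrite mul1r dA.
  by rewrite big_nil /= !mul1r lerDl.
have gap : 0 < p i - `|q i| / theta.
  by rewrite subr_gt0 ltr_pdivrMr // mulrC.
pose k := (p i - `|q i| / theta)^-1.
have k_ge0 : 0 <= k by rewrite invr_ge0 ltW.
exists (K * k + (p i * (K * k) + `|q i| * k)).
  by rewrite !addr_ge0 ?mulr_ge0 // ltW.
move=> A B d A_ge0 dB dA.
have [C bC] := prod_op_bounded s B.
(* The hypothesis controls the operator only from index 1 on, so the outer factor is inverted on the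
   sequence shifted by one. *)
have e_le j : `|prod_op s d j.+1| * theta ^+ j <= A * k.
  apply: (@factor_op_bound (p i) (q i) theta A C (fun j => prod_op s d j.+1))
    => // m; exact: bC.
have [d_le d0_le] := IHs (A * k) B d (mulr_ge0 A_ge0 k_ge0) dB e_le.
have nonneg : 0 <= p i * (K * k) * A /\ 0 <= `|q i| * k * A /\ 0 <= K * k * A.
  by rewrite !mulr_ge0 // ltW.
split=> [j|]; first by rewrite (le_trans (d_le j)) //; lra.
rewrite big_cons /= /factor_op (le_trans (ler_normB _ _)) // !normrM.
have := e_le 0%N; rewrite expr0 mulr1 => /(ler_wpM2l (normr_ge0 (q i))) h1.
have := ler_wpM2l (ltW (p_gt0 i)) d0_le; rewrite (gtr0_norm (p_gt0 i)); lra.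
Qed.

End ShiftOperators.

(** * Geometric sequences with integer values *)

(** Every power of the denominator of [y] divides the nonzero integer [x], so this denominator is
    1. *)
Lemma rat_geometric_int (x y : rat) :
    x != 0 -> (forall m, x * y ^+ m \is a Num.int) -> y \is a Num.int.
Proof.
move=> x_neq0 xy_int; have := xy_int 0; rewrite mulr1 => /intrP[z xE].
rewrite Qint_def; apply/eqP.
have z_neq0 : z != 0 by apply: contraNneq x_neq0 => z0; rewrite xE z0.
have dvd m : (denq y ^+ m %| z)%Z.
  have /intrP[w wE] := xy_int m.
  have denm : (denq y)%:~R ^+ m != 0 :> rat.
    by rewrite expf_neq0 // intr_eq0 denq_neq0.
  have eqz : z * numq y ^+ m = w * denq y ^+ m.
    apply: (@intr_inj rat); rewrite !rmorphM !rmorphXn /= -wE xE.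
    by rewrite -{2}(divq_num_den y) expr_div_n -mulrA divfK.
  rewrite -(@Gauss_dvdzl _ z (numq y ^+ m)); first by rewrite eqz dvdz_mull.
  by apply/coprimezXl/coprimezXr;
    rewrite coprimez_sym coprimezE coprime_num_den.
apply/eqP/contraT => den_neq1.
have den_gt1 : (1 < `|denq y|)%N.
  by have := denq_gt0 y; lia.
have := dvd `|z|%N; rewrite dvdzE => /dvdn_leq.
rewrite absz_gt0 z_neq0 => /(_ isT).
by rewrite abszX leqNgt ltn_expl.
Qed.

Lemma real_geometric_int (R : realType) (x r : R) :
    x != 0 -> rational r -> (forall m, x * r ^+ m \is a Num.int) ->
  rational x /\ r \is a Num.int.
Proof.
move=> x_neq0 [y _ <-] xr_int.
have := xr_int 0; rewrite mulr1 => /intrP[z xE].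
split; first by exists z%:~R => //; rewrite ratr_int.
have : y \is a Num.int.
  apply: (@rat_geometric_int z%:~R).
    by apply: contraNneq x_neq0 => z0; rewrite xE -ratr_int z0 rmorph0.
  move=> m; have /intrP[w wE] := xr_int m; apply/intrP; exists w.
  apply: (fmorph_inj (@ratr R)); rewrite rmorphM rmorphXn /= !ratr_int -wE xE.
  by [].
by case/intrP => w ->; rewrite ratr_int intr_int.
Qed.

(** * Oscillation and coding of bounded sequences *)

Lemma near_diff_le_of_limn_gap (R : realType) (u : nat -> R) (B c : R) :
    (forall k, `|u k| <= B) -> limn_sup u - limn_inf u < c ->
  (\forall N \near \oo, forall k k', (N <= k)%N -> (N <= k')%N ->
    `|u k - u k'| <= c - N.+1%:R^-1)%classic.
Proof.
move=> uB gap.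
have bu : bounded_fun u.
  exists B; split; first exact: num_real.
  by move=> x ltBx k _ /=; rewrite (le_trans (uB k)) // ltW.
have ub : has_ubound (range u) by exact: bounded_fun_has_ubound.
have lb : has_lbound (range u) by exact: bounded_fun_has_lbound.
have cs : (sups u @ \oo --> limn_sup u)%classic.
  by rewrite limn_supE //; exact: cvg_sups_inf.
have ci : (infs u @ \oo --> limn_inf u)%classic.
  by rewrite limn_infE //; exact: cvg_infs_sup.
(* One third of the gap is lost at each end of the range of the tail; the last third exceeds
   1/(N+1). *)
pose e := (c - (limn_sup u - limn_inf u)) / 3.
have e_gt0 : 0 < e by rewrite divr_gt0 // subr_gt0.
near=> N => k k' leNk leNk'.
have sN : sups u N < limn_sup u + e.
  near: N; apply: (cvgr_lt _ cs); by rewrite ltrDl.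
have iN : limn_inf u - e < infs u N.
  near: N; apply: (cvgr_gt _ ci); by rewrite gtrDl oppr_lt0.
have eN : N.+1%:R^-1 < e by
  near: N; exact: (near_infty_natSinv_lt (PosNum e_gt0)).
have u_le m : (N <= m)%N -> u m <= sups u N.
  by move=> leNm; apply: ub_le_sup; [exact: has_ubound_sdrop|exists m].
have le_u m : (N <= m)%N -> infs u N <= u m.
  by move=> leNm; apply: ge_inf; [exact: has_lbound_sdrop|exists m].
have := (u_le _ leNk, u_le _ leNk', le_u _ leNk, le_u _ leNk').
have eE : 3 * e = c - (limn_sup u - limn_inf u) by rewrite /e mulrC divfK.
move=> [[[h1 h2] h3] h4].
set a := sups u N in sN h1 h2 *; set b := infs u N in iN h3 h4 *.
set v := N.+1%:R^-1 in eN *; set x := limn_sup u in sN eE *.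
set y := limn_inf u in iN eE *; clearbody a b v x y e.
by rewrite ler_norml; apply/andP; split; lra.
Unshelve. all: by end_near.
Qed.

(** Provides the finite alphabet that the periodicity argument requires. *)
Lemma bounded_int_code (z : nat -> int) (Z : nat) :
    (forall m, `|z m| <= Z%:Z) ->
  exists (K : nat) (beta : nat -> 'I_K),
    forall m m', beta m = beta m' <-> z m = z m'.
Proof.
move=> zZ; exists (Z + Z).+1, (fun m => inord (absz (z m + Z%:Z))) => m m'.
split=> [/(congr1 val)|->//]; have := (zZ m, zZ m') => -[zm zm'].
by rewrite /= !inordK; lia.
Qed.

(** * Rationality and integer-valued power sums *)

Lemma rational_mulr_cancel (R : realType) (x y : R) :
  rational x -> x != 0 -> rational (y * x) -> rational y.
Proof.
move=> [a _ <-] a_neq0 [c _ cE]; exists (c / a) => //.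
by rewrite fmorph_div /= cE mulfK.
Qed.

Lemma rational_int_poly (R : realType) (I : Type) (s : seq I) (p q : I -> int)
    (x : R) :
  rational x -> rational (\prod_(i <- s) ((q i)%:~R * x - (p i)%:~R)).
Proof.
move=> [a _ <-]; exists (\prod_(i <- s) ((q i)%:~R * a - (p i)%:~R)) => //.
rewrite rmorph_prod; apply: eq_bigr => i _.
by rewrite rmorphB rmorphM /= !ratr_int.
Qed.

Lemma power_sum_int_rigid (R : realType) (n : nat) (eta r : 'I_n -> R)
    (p q : 'I_n -> int) (i0 : 'I_n) :
    eta i0 != 0 -> injective r -> (forall i, q i != 0) ->
    (forall i, r i = (p i)%:~R / (q i)%:~R) ->
    (forall m, \sum_(i < n) eta i * r i ^+ m \is a Num.int) ->
  rational (eta i0) /\ r i0 \is a Num.int.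
Proof.
move=> eta_neq0 r_inj q_neq0 rE y_int.
have qR i : (q i)%:~R != 0 :> R by rewrite intr_eq0.
have rat_r : rational (r i0).
  by exists ((p i0)%:~R / (q i0)%:~R) => //; rewrite fmorph_div /= !ratr_int rE.
pose s := [seq i <- enum 'I_n | i != i0].
(* [c i] is the eigenvalue of the operator on the powers of [r i]; as the ratios are distinct, it is
   nonzero exactly at [i0]. *)
pose c i := \prod_(j <- s) ((q j)%:~R * r i - (p j)%:~R).
have factor0 i j : ((q j)%:~R * r i - (p j)%:~R == 0) = (i == j).
  rewrite subr_eq0; apply/eqP/eqP => [eqr|->].
    by apply: r_inj; rewrite [RHS]rE -eqr mulrC mulKf.
  by rewrite rE mulrC divfK.
have c0 i : i != i0 -> c i = 0.
  move=> ne; apply/eqP; rewrite prodf_seq_eq0; apply/hasP; exists i => /=.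
    by rewrite mem_filter ne mem_enum.
  by rewrite factor0.
have ci0 : c i0 != 0.
  rewrite prodf_seq_neq0; apply/allP => j; rewrite mem_filter => /andP[ne _] /=.
  by rewrite factor0 eq_sym.
have c_int m : eta i0 * c i0 * r i0 ^+ m \is a Num.int.
  have := @prod_op_int R _ (fun i => (p i)%:~R) (fun i => (q i)%:~R) s _ m
    (fun=> intr_int _ _) (fun=> intr_int _ _) y_int.
  rewrite prod_op_sum (bigD1 i0) //= [X in _ + X]big1 => [|i ne].
    by rewrite addr0 prod_op_geometric.
  by rewrite prod_op_geometric -/(c i) c0 // mulr0 mul0r.
have [rat_ec r_int] := real_geometric_int (mulf_neq0 eta_neq0 ci0) rat_r c_int.
by split=> //; apply: rational_mulr_cancel rat_ec => //;
  exact: rational_int_poly.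
Qed.

(** * Backward determinism of the integer word *)

Lemma frac_part_itv (R : realType) (x : R) : 0 <= frac_part x < 1.
Proof.
rewrite /frac_part; have := floor_itv x; rewrite intrD => /andP[h1 h2].
by apply/andP; split; lra.
Qed.

Lemma uniform_contraction (R : realType) (n : nat) (p q : 'I_n -> int) :
    (forall i, `|q i| < p i /\ 0 < `|q i|) ->
  exists theta : R, [/\ 0 < theta, theta < 1 &
    forall i, `|(q i)%:~R| < theta * (p i)%:~R].
Proof.
move=> pq; pose S : R := \sum_i (p i)%:~R + 1.
have p_ge0 i : 0 <= (p i)%:~R :> R by rewrite ler0z; have := pq i; lia.
have S_ge1 : 1 <= S by rewrite lerDr sumr_ge0.
have S_gt0 : 0 < S by rewrite (lt_le_trans _ S_ge1).
have Sinv : 0 < S^-1 <= 1 by rewrite invr_gt0 S_gt0 invf_le1.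
(* As p_i <= S, theta p_i >= p_i - 1/2, which exceeds |q_i| because |q_i| <= p_i - 1. *)
exists (1 - S^-1 / 2); split; [lra|lra|move=> i].
have qp : `|(q i)%:~R| + 1 <= (p i)%:~R :> R.
  by rewrite -intr_norm -[1]/(1%:~R) -intrD ler_int; have := pq i; lia.
have : (p i)%:~R * S^-1 <= 1.
  rewrite ler_pdivrMr // mul1r /S (bigD1 i) //= -addrA lerDl addr_ge0 //.
  by rewrite sumr_ge0.
lra.
Qed.

(** For the difference of two shifts of [x], the operator vanishes at the next N places. Its value
    at 0 is then below P (1/P - eps) + P eps = 1 in size, with P the product of the [p i]; being an
    integer, it is 0. *)
Lemma prod_op_backward_deterministic (R : realType) (I : eqType) (s : seq I)
    (p q : I -> R) (theta eps : R) (x : nat -> R) (m0 : nat) (E : rel nat) :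
    0 < theta -> theta < 1 -> (forall i, `|q i| < theta * p i) ->
    0 < eps -> (forall m, `|x m| <= 1) ->
    (forall m, prod_op p q s x m \is a Num.int) ->
    (forall m m', (m0 <= m)%N -> (m0 <= m')%N -> E m m' ->
       `|x m - x m'| <= (\prod_(i <- s) p i)^-1 - eps) ->
  exists N, forall m m', (m0 <= m)%N -> (m0 <= m')%N -> E m m' ->
    (forall j, (j < N)%N ->
       prod_op p q s x (m + j.+1)%N = prod_op p q s x (m' + j.+1)%N) ->
    prod_op p q s x m = prod_op p q s x m'.
Proof.
move=> th_gt0 th_lt1 lt_qp eps_gt0 x_le1 b_int close.
set b := prod_op p q s x in b_int *.
have P_gt0 : 0 < \prod_(i <- s) p i.
  apply: prodr_gt0 => i _.
  by rewrite -(pmulr_rgt0 _ th_gt0) (le_lt_trans _ (lt_qp i)).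
set P := \prod_(i <- s) p i in P_gt0 close *.
have [K K_ge0 bound] := prod_op_bound s th_gt0 (ltW th_lt1) lt_qp.
have [C bC] := prod_op_bounded p q s 2.
have C_ge0 : 0 <= C.
  by apply: le_trans (bC (fun=> 0) _ 0%N) => // k; rewrite normr0.
have [N small] : exists N, K * C * theta ^+ N < P * eps.
  have th_norm : `|theta| < 1 by rewrite gtr0_norm.
  have /cvgr_lt /(_ (P * eps)) := cvg_geometric (K * C) th_norm.
  rewrite mulr_gt0 // => /(_ isT) [N _ HN].
  by exists N; apply: (HN N); rewrite /= leqnn.
exists N => m m' le_m le_m' Emm' eqb.
pose d k := x (k + m)%N - x (k + m')%N.
have dE j : prod_op p q s d j = b (j + m)%N - b (j + m')%N.
  by rewrite prod_opB !prod_op_shift.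
have d_le2 k : `|d k| <= 2.
  by rewrite (le_trans (ler_normB _ _)) // -[2]/(1 + 1) lerD.
have th_ge0 k : 0 <= theta ^+ k by rewrite exprn_ge0 // ltW.
have A_ge0 : 0 <= C * theta ^+ N by rewrite mulr_ge0.
(* Below N the common word gives 0; from N on the weight is at most theta^N. *)
have dA j : `|prod_op p q s d j.+1| * theta ^+ j <= C * theta ^+ N.
  have [lt_jN|le_Nj] := ltnP j N.
    by rewrite dE addnC (addnC j.+1) eqb // subrr normr0 mul0r.
  by rewrite ler_pM // ?bC // ler_wiXn2l // ltW.
have [_ ] := bound _ 2 d A_ge0 d_le2 dA.
rewrite dE !add0n -/P => b_le.
have /intrP[z zE] : b m - b m' \is a Num.int by rewrite rpredB.
have d0 := ler_wpM2l (ltW P_gt0) (close _ _ le_m le_m' Emm').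
have : `|b m - b m'| < 1.
  rewrite (le_lt_trans b_le) //.
  move: d0; rewrite mulrBr divff ?gt_eqF // /d !add0n; lra.
rewrite zE -intr_norm (ltr_int R _ 1) => z_lt1.
by apply/eqP; rewrite -subr_eq0 zE; have -> : z = 0 by lia.
Qed.

Lemma frac_part_diff_int (R : realType) (x y : R) :
  frac_part x = frac_part y -> x - y \is a Num.int.
Proof.
rewrite /frac_part => eqf.
have -> : x - y = (Num.floor x)%:~R - (Num.floor y)%:~R by move: eqf; lra.
by rewrite rpredB ?intr_int.
Qed.

(** * From small oscillation to periodicity and a contradiction *)

Theorem theorem1p1 (R : realType) (n : nat) (n_gt0 : (0 < n)%N)
    (xi : 'I_n -> R) (p q : 'I_n -> int)
    (xi_neq0 : forall i, xi i != 0)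
    (pq : forall i, `|q i| < p i /\ 0 < `|q i|)
    (ratio_inj : injective (fun i => (p i)%:~R / (q i)%:~R : R))
    (first : irrational (xi (Ordinal n_gt0)) \/
             ((p (Ordinal n_gt0))%:~R / (q (Ordinal n_gt0))%:~R : R)
               \isn't a Num.int)
    (M : int) (M_ge1 : 1 <= M) :
  exists l : int,
    let u := fun k : nat =>
      frac_part (\sum_(i < n)
                   xi i * ((p i)%:~R / (q i)%:~R) ^ (k%:Z * M + l)) in
    limn_sup u - limn_inf u >= 1 / (\prod_(i < n) p i)%:~R.
Proof.
set i0 := Ordinal n_gt0 in first *.
pose r i : R := (p i)%:~R / (q i)%:~R.
pose x m := frac_part (\sum_(i < n) xi i * r i ^+ m).
pose pR i : R := (p i)%:~R; pose qR i : R := (q i)%:~R.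
pose s := index_enum 'I_n.
have qR_neq0 i : qR i != 0 by rewrite intr_eq0 -normr_gt0; case: (pq i).
have x_ge0 m : 0 <= x m by case/andP: (frac_part_itv (\sum_i xi i * r i ^+ m)).
have x_lt1 m : x m < 1 by case/andP: (frac_part_itv (\sum_i xi i * r i ^+ m)).
have x_le1 m : `|x m| <= 1 by rewrite ger0_norm // ltW.
have [theta [th_gt0 th_lt1 lt_qp]] := uniform_contraction R pq.
have b_int m : prod_op pR qR s x m \is a Num.int.
  rewrite prod_opB prod_op_sum big1 => [|i _].
    rewrite sub0r rpredN prod_op_int // => *; exact: intr_int.
  rewrite prod_op_geometric (bigD1_seq i) ?mem_index_enum ?index_enum_uniq //=.
  by rewrite [qR i * _]mulrC divfK ?qR_neq0 // subrr mul0r mulr0 mul0r.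
have [M' M'_gt0 ->] : exists2 M' : nat, (0 < M')%N & M = M'%:Z.
  by exists (absz M); lia.
apply: contrapT => no_l.
pose c := (\prod_(i <- s) pR i)^-1.
have gap (l : 'I_M') :
    limn_sup (fun k => x (k * M' + l)%N) - limn_inf (fun k => x (k * M' + l)%N)
      < c.
  rewrite ltNge; apply/negP => ge_c; apply: no_l; exists (l : nat)%:Z => /=.
  rewrite rmorph_prod div1r; move: ge_c; congr (c <= limn_sup _ - limn_inf _);
    by apply/funext => k; rewrite -PoszM -PoszD.
(* There are finitely many residues, so one N, with margin 1/(N+1), serves them all. *)
have [N _ /(_ N (leqnn N)) closeN] := filter_forall _ (fun l : 'I_M' =>
  near_diff_le_of_limn_gap (fun k => x_le1 (k * M' + l)%N) (gap l)).
have eps_gt0 : 0 < N.+1%:R^-1 :> R by rewrite invr_gt0.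
have close m m' : (N * M' <= m)%N -> (N * M' <= m')%N -> m == m' %[mod M'] ->
    `|x m - x m'| <= c - N.+1%:R^-1.
  move=> le_m le_m' /eqP modE.
  have := closeN (Ordinal (ltn_pmod m M'_gt0)) (m %/ M')%N (m' %/ M')%N.
  rewrite /= !leq_divRL // => /(_ le_m le_m').
  by rewrite -divn_eq modE -divn_eq.
have [N' back] := prod_op_backward_deterministic th_gt0 th_lt1 lt_qp eps_gt0
  x_le1 b_int close.
have [C bC] := prod_op_bounded pR qR s 1.
have [K [beta betaE]] : exists (K : nat) (beta : nat -> 'I_K), forall m m',
    beta m = beta m' <-> prod_op pR qR s x m = prod_op pR qR s x m'.
  have floorb m : (Num.floor (prod_op pR qR s x m))%:~R = prod_op pR qR s x m.
    by apply: floorK.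
  have C_ge0 : 0 <= C := le_trans (normr_ge0 _) (bC x x_le1 0%N).
  have [|K [beta betaE]] := @bounded_int_code
      (fun m => Num.floor (prod_op pR qR s x m)) (Num.bound C).
    move=> m; rewrite -(ler_int R) intr_norm floorb.
    by rewrite (le_trans (bC x x_le1 m)) // ltW // archi_boundP.
  exists K, beta => m m'; rewrite betaE; split=> [eqf|->//].
  by rewrite -floorb eqf floorb.
have [t [t_gt0 per]] := eventually_periodic (b := beta) (N := N') (m0 := N * M')
  M'_gt0 (fun m m' lem lem' modE eqb => proj2 (betaE m m') (back m m' lem lem'
    (introT eqP modE) (fun j ltj => proj1 (betaE _ _) (eqb j ltj)))).
have [Kb Kb_ge0 bound] := prod_op_bound s th_gt0 (ltW th_lt1) lt_qp.
set m0 := (N * M')%N in per.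
(* The operator kills the difference of the two shifts from index 1 on, so the bound with A = 0
   makes that difference vanish there. *)
have x_per k : x (k.+1 + (m0 + t))%N = x (k.+1 + m0)%N.
  have [||/(_ k) + _] := bound 0 1 (fun k => x (k + (m0 + t))%N - x (k + m0)%N)
    (lexx 0).
  - move=> j; rewrite ler_norml.
    have := (x_ge0 (j + (m0 + t))%N, x_ge0 (j + m0)%N).
    have := (x_lt1 (j + (m0 + t))%N, x_lt1 (j + m0)%N) => -[h1 h2] [h3 h4].
    by apply/andP; split; lra.
  - move=> j; rewrite prod_opB !prod_op_shift addnA.
    have /betaE -> := per (j.+1 + m0)%N (leq_addl _ _).
    by rewrite subrr normr0 mul0r.
  rewrite mulr0 pmulr_lle0 ?exprn_gt0 // normr_le0 subr_eq0.
  by move/eqP.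
have r_gt1 i : 1 < `|r i|.
  have [lt_qp' q_gt0] := pq i.
  rewrite normf_div ltr_pdivlMr ?normr_gt0 ?qR_neq0 // mul1r.
  rewrite -!intr_norm ltr_int.
  by rewrite (lt_le_trans lt_qp') // ler_norm.
have r_neq0 i : r i != 0 by rewrite -normr_gt0 (lt_trans _ (r_gt1 i)).
have rt_neq1 i : r i ^+ t - 1 != 0.
  rewrite subr_eq0; apply: contraTneq (r_gt1 i) => rt1; rewrite -leNgt.
  by rewrite -(expr_le1 t_gt0) // -normrX rt1 normr1.
(* These are the coefficients of s_(m+t) - s_m once the index is shifted by [m0.+1]; they are
   nonzero because |r_i| > 1. *)
have [||||m|rat_eta r_int] := @power_sum_int_rigid R n
  (fun i => xi i * (r i ^+ t - 1) * r i ^+ m0.+1) r p q i0.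
- by rewrite !mulf_neq0 ?expf_neq0.
- exact: ratio_inj.
- by move=> i; rewrite -(intr_eq0 R); exact: qR_neq0.
- by [].
- have := frac_part_diff_int (x_per m); rewrite -sumrB.
  congr (_ \is a Num.int); apply: eq_bigr => i _.
  have -> : (m.+1 + (m0 + t) = t + m0.+1 + m)%N by lia.
  have -> : (m.+1 + m0 = m0.+1 + m)%N by lia.
  by rewrite !exprD; ring.
case: first => [irr|/negP]; last by apply.
have [a aE] : exists a : rat, r i0 = ratr a.
  by exists ((p i0)%:~R / (q i0)%:~R); rewrite fmorph_div /= !ratr_int.
apply: irr; apply: (@rational_mulr_cancel _ ((r i0 ^+ t - 1) * r i0 ^+ m0.+1)).
- exists ((a ^+ t - 1) * a ^+ m0.+1) => //.
  by rewrite rmorphM rmorphB !rmorphXn /= rmorph1 -aE.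
- by rewrite mulf_neq0 ?expf_neq0.
- by rewrite mulrA.
Qed.
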